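(* Let $(X,d)$ be a compact metric space and $T\colon X\to X$ a homeomorphism. If $T$ is expansive with expansivity constant $\alpha>0$, then the following conditions are equivalent. (1) $T$ has the shadowing property. (2) There exists $\delta>0$ such that every one-jump $\delta$-pseudo orbit of $T$ is $\alpha$-shadowed.
   Context: $T$ is expansive with expansivity constant $\alpha>0$ if, whenever $x,y\in X$ satisfy $d(T^nx,T^ny)\leq\alpha$ for all $n\in\mathbb Z$, one has $x=y$. For $\delta>0$, a $\delta$-pseudo orbit of $T$ is a bi-sequence $\xi=(x_n)_{n\in\mathbb Z}$ of elements of $X$ such that $d(Tx_n,x_{n+1})<\delta$ for all $n\in\mathbb Z$. The bi-sequence $\xi$ has a jump at the $n$-th step if $Tx_{n-1}\neq x_n$; a one-jump $\delta$-pseudo orbit is a $\delta$-pseudo orbit having a jump at exactly one step $n\in\mathbb Z$. For $\varepsilon>0$, a bi-sequence $\xi=(x_n)_{n\in\mathbb Z}$ is $\varepsilon$-shadowed (or $\varepsilon$-shadowable) if there is a point $x\in X$ with $d(x_n,T^nx)<\varepsilon$ for all $n\in\mathbb Z$. $T$ has the $\varepsilon$-shadowing property if for some $\delta>0$ every $\delta$-pseudo orbit of $T$ is $\varepsilon$-shadowed, and $T$ has the shadowing property if it has the $\varepsilon$-shadowing property for all $\varepsilon>0$. *)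

(* Defs.v *)
From mathcomp Require Import all_boot all_order all_algebra.
From mathcomp Require Import all_classical all_reals all_analysis.
Set Implicit Arguments.
Unset Strict Implicit.
Unset Printing Implicit Defensive.
Import Order.TTheory GRing.Theory Num.Theory.
Local Open Scope classical_set_scope.
Local Open Scope ring_scope.

(* The inverse is part of the data (it is determined by the map), so that the
   iterates T^n with n < 0 are defined without choice. *)
Record homeomorphism (X : topologicalType) := Homeomorphism {
  homeo_fun :> X -> X;
  homeo_inv : X -> X;
  homeo_funK : cancel homeo_fun homeo_inv;
  homeo_invK : cancel homeo_inv homeo_fun;
  homeo_fun_continuous : continuous homeo_fun;
  homeo_inv_continuous : continuous homeo_inv
}.

(* [Negz k] is the integer - (k + 1). *)
Definition iterz (X : topologicalType) (T : homeomorphism X) (n : int)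
    (x : X) : X :=
  match n with
  | Posz k => iter k T x
  | Negz k => iter k.+1 (homeo_inv T) x
  end.

Section Shadowing.
Variables (R : realType) (X : metricType R) (T : homeomorphism X).

Definition expansivity_constant (alpha : R) : Prop :=
  0 < alpha /\
  forall x y : X,
    (forall n : int, mdist (iterz T n x) (iterz T n y) <= alpha) -> x = y.

Definition pseudo_orbit (delta : R) (xi : int -> X) : Prop :=
  forall n : int, mdist (T (xi n)) (xi (n + 1)) < delta.

Definition jump_at (xi : int -> X) (n : int) : Prop := T (xi (n - 1)) <> xi n.

Definition one_jump_pseudo_orbit (delta : R) (xi : int -> X) : Prop :=
  pseudo_orbit delta xi /\ exists! n : int, jump_at xi n.

Definition shadowed (eps : R) (xi : int -> X) : Prop :=
  exists x : X, forall n : int, mdist (xi n) (iterz T n x) < eps.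

Definition eps_shadowing_property (eps : R) : Prop :=
  exists2 delta : R, 0 < delta &
    forall xi : int -> X, pseudo_orbit delta xi -> shadowed eps xi.

Definition shadowing_property : Prop :=
  forall eps : R, 0 < eps -> eps_shadowing_property eps.

End Shadowing.

(* Main.v *)
Require Import Defs.
From mathcomp Require Import all_boot all_order all_algebra.
From mathcomp Require Import all_classical all_reals all_analysis.
From mathcomp Require Import zify lra.
Local Open Scope classical_set_scope.
Local Open Scope ring_scope.
Import Order.TTheory GRing.Theory Num.Theory.
Import numFieldNormedType.Exports.

(** Suppose that every one-jump [delta]-pseudo orbit is [alpha]-shadowed; the
    other implication is immediate, a one-jump pseudo orbit being a pseudo
    orbit.

    Everything rests on a rigidity property of expansive homeomorphisms of a
    compact space ([expansive_tracking]): for each [g > 0], if an orbit stays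
    within [alpha] of a pseudo orbit with sufficiently small jumps, then it
    stays within [g] of it.  Otherwise, take pseudo orbits whose jumps tend to
    0, tracked within [alpha] but not within [g], recentre each of them at a
    bad time, and pass to the limit: over any bounded time window a pseudo orbit
    with tiny jumps is almost a true orbit, so in the limit there are two points
    at distance at least [g] whose orbits remain within [alpha] of each other,
    which expansivity forbids.

    Rigidity first improves the hypothesis: pseudo orbits with one small enough
    jump are [alpha / 2]-shadowed ([one_jump_shadowed_small]).  Then jumps can
    be added one at a time without loss of precision.  Fix a small
    [g <= alpha / 2] and let [w] track within [g] a pseudo orbit that is a true
    orbit from time [m] on.  To jump to a point [y] at time [m + 1], glue the
    past of the orbit of [w] to the future of [y]; this has a single small jump,
    hence is tracked within [alpha / 2] by some [z].  So [z] tracks the new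
    pseudo orbit within [g + alpha / 2 <= alpha], and rigidity brings this back
    to [g].  Thus a pseudo orbit is [g]-shadowed over each bounded time window,
    with jumps bounded independently of the window; a limit of the shadowing
    points tracks it within [g] at all times, up to equality, and rigidity makes
    the inequality strict again. *)

Set Implicit Arguments.
Unset Strict Implicit.

(** * Compactness and uniform continuity *)

Section Compactness.

(** This is how limits are taken: any cluster point of [u] serves as [p].  It
    stands for the limit of a subsequence, with the advantage that one [p]
    works for all the continuous functions [f] simultaneously. *)
Lemma compact_limit_le (R : realType) (Y : topologicalType)
    (Y_compact : compact [set: Y]) (u : nat -> Y) :
  exists p : Y, forall (f : Y -> R) (c : R), continuous f ->
    (forall s : R, 0 < s -> \forall k \near \oo, f (u k) <= c + s) ->
    f p <= c.
Proof.
have [p [_ clp]] := Y_compact (u @ \oo) _ filterT.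
exists p => f c fcont fu; rewrite leNgt; apply/negP => cfp.
pose s := (f p - c) / 2; have s0 : 0 < s by rewrite divr_gt0// subr_gt0.
have nbfp : nbhs p [set y | c + s < f y].
  apply: (fcont p [set r | c + s < r]).
  by apply: lt_nbhsr; rewrite /s; lra.
have [q [/= q1 q2]] := clp [set y | f y <= c + s] _ (fu s s0) nbfp.
by move: q1; rewrite leNgt q2.
Qed.

Variables (R : realType) (X : metricType R).

Lemma mdist_continuous : continuous (fun p : X * X => mdist p.1 p.2 : R).
Proof.
move=> [x y]; apply/cvgrPdist_lt => e e0 /=.
have e2 : 0 < e / 2 by rewrite divr_gt0.
exists (ball x (e / 2), ball y (e / 2)) => /=.
  by split; exact: nbhsx_ballx.
move=> [x' y'] /=; rewrite !ballEmdist/= => -[xx' yy'].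
have t1 := metric_triangle x x' y; have t2 := metric_triangle x' y' y.
have t3 := metric_triangle x' x y'; have t4 := metric_triangle x y y'.
rewrite (metric_sym y' y) (metric_sym x' x) in t1 t2 t3 t4.
by rewrite ltr_norml; lra.
Qed.

Lemma near_invSn_lt (d : R) : 0 < d -> \forall k \near \oo, k.+1%:R^-1 < d.
Proof. by move=> d0; exact: (near_infty_natSinv_lt (PosNum d0)). Qed.

Lemma continuous_mdist_comp (Y : topologicalType) (f g : Y -> X) :
  continuous f -> continuous g ->
  continuous (fun p => mdist (f p) (g p) : R).
Proof.
move=> fc gc p.
have fgp : (fun q => (f q, g q)) @ p --> (f p, g p).
  exact: cvg_pair (fc p) (gc p).
exact: (cvg_comp _ _ fgp (@mdist_continuous (f p, g p))).
Qed.

Lemma continuous_mdist_map2 (f g : X -> X) : continuous f -> continuous g ->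
  continuous (fun q : X * X => mdist (f q.1) (g q.2) : R).
Proof.
move=> fc gc; apply: continuous_mdist_comp => r.
  exact: (continuous_comp (@cvg_fst _ _ _ _ _) (fc r.1)).
exact: (continuous_comp (@cvg_snd _ _ _ _ _) (gc r.2)).
Qed.

Hypothesis X_compact : compact [set: X].

Lemma compact_square : compact [set: X * X].
Proof. by rewrite -setXTT; exact: compact_setX. Qed.

(** The Heine-Cantor theorem, by passing to the limit in pairs that violate
    uniform continuity. *)
Lemma uniform_continuity (f : X -> X) (e : R) : continuous f -> 0 < e ->
  exists2 d : R, 0 < d &
    forall x y, mdist x y < d -> mdist (f x) (f y) < e.
Proof.
move=> fc e0; apply: contrapT => nd.
have ce k : exists u : X * X,
    mdist u.1 u.2 < k.+1%:R^-1 :> R /\ e <= mdist (f u.1) (f u.2).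
  apply: contrapT => nu; apply: nd; exists k.+1%:R^-1 => // x y xy.
  by rewrite ltNge; apply/negP => exy; apply: nu; exists (x, y).
have [u uP] := choice ce.
have [p pP] := @compact_limit_le R _ compact_square u.
have p12 : p.1 = p.2.
  apply: mdist_positivity; apply/eqP; rewrite eq_le mdist_ge0 andbT.
  apply: (pP (fun q => mdist q.1 q.2)) => [|s s0].
    exact: mdist_continuous.
  near=> k; rewrite add0r; apply: ltW; apply: lt_trans (uP k).1 _.
  by near: k; exact: near_invSn_lt.
have : - mdist (f p.1) (f p.2) <= - e.
  apply: (pP (fun q => - mdist (f q.1) (f q.2))) => [q|s s0].
    by apply: cvgN; exact: continuous_mdist_map2.
  by near=> k; have := (uP k).2; lra.
by rewrite p12 mdistxx; lra.
Unshelve. all: by end_near. Qed.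

End Compactness.

(** * Integer iterates and gluing of bi-sequences *)

Section Iterates.
Variables (X : topologicalType) (T : homeomorphism X).

Lemma iterzS n x : iterz T (n + 1) x = T (iterz T n x).
Proof.
case: n => [n|n]; first by rewrite -PoszD addn1.
case: n => [|n]; first by rewrite /= homeo_invK.
have -> : Negz n.+1 + 1 = Negz n by rewrite !NegzE; lia.
by rewrite /= homeo_invK.
Qed.

Lemma iterz_pred n x : iterz T (n - 1) x = homeo_inv T (iterz T n x).
Proof. by rewrite -[in RHS](subrK 1 n) iterzS homeo_funK. Qed.

Lemma iterzD m n x : iterz T (m + n) x = iterz T m (iterz T n x).
Proof.
elim/int_ind: m => [|m IH|m IH]; first by rewrite add0r.
  by rewrite -addn1 PoszD addrAC !iterzS IH.
have -> : - m.+1%:Z = - m%:Z - 1 by lia.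
by rewrite addrAC !iterz_pred IH.
Qed.

Lemma iterz_continuous n : continuous (iterz T n).
Proof.
elim/int_ind: n => [|n IH|n IH] x; first exact: cvg_id.
  have -> : iterz T n.+1 = T \o iterz T n by [].
  apply: continuous_comp; [exact: IH | exact: homeo_fun_continuous].
have -> : - n.+1%:Z = - n%:Z - 1 by lia.
have -> : iterz T (- n%:Z - 1) = homeo_inv T \o iterz T (- n%:Z).
  by apply/funext => y; rewrite iterz_pred.
apply: continuous_comp; [exact: IH | exact: homeo_inv_continuous].
Qed.

Definition orbit_through (m : int) x (n : int) := iterz T (n - m) x.

Definition glue (m : int) (xi eta : int -> X) n := if n < m then xi n else eta n.

Lemma orbit_throughS m x n :
  T (orbit_through m x n) = orbit_through m x (n + 1).
Proof. by rewrite /orbit_through addrAC iterzS. Qed.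

Lemma orbit_through_id m x : orbit_through m x m = x.
Proof. by rewrite /orbit_through subrr. Qed.

Lemma orbit_throughE m x n : orbit_through m x n = iterz T n (iterz T (- m) x).
Proof. by rewrite -iterzD. Qed.

Lemma orbit_through_iterz m x n : orbit_through m (iterz T m x) n = iterz T n x.
Proof. by rewrite /orbit_through -iterzD subrK. Qed.

Lemma glue_orbit_before m xi n : n < m + 1 ->
  glue m xi (orbit_through m (xi m)) n = xi n.
Proof.
rewrite /glue => nm; case: ltP => // mn; have -> : n = m by lia.
exact: orbit_through_id.
Qed.

(** The second gluing takes place at time [M + 1], in the form in which it is
    reached from [- M] by [2 M + 1] steps of length one. *)
Lemma glue_truncation (M : nat) (xi eta zeta : int -> X) n :
  `|n| <= M%:Z ->
  glue (- M%:Z + (M + M).+1%:Z) (glue (- M%:Z) eta xi) zeta n = xi n.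
Proof.
by move=> nM; rewrite /glue ifT ?ifF //; lia.
Qed.

End Iterates.

(** * Rigidity and shadowing *)

Section Shadowing.
Variables (R : realType) (X : metricType R) (T : homeomorphism X).
Hypothesis X_compact : compact [set: X].

Lemma pseudo_orbit_le (d1 d2 : R) xi : d1 <= d2 ->
  pseudo_orbit T d1 xi -> pseudo_orbit T d2 xi.
Proof. by move=> d12 xiP n; exact: lt_le_trans (xiP n) d12. Qed.

Lemma pseudo_orbit_orbit_through (d : R) m x : 0 < d ->
  pseudo_orbit T d (orbit_through T m x).
Proof. by move=> d0 n; rewrite orbit_throughS mdistxx. Qed.

Lemma pseudo_orbit_glue (d : R) m xi eta :
  pseudo_orbit T d xi -> pseudo_orbit T d eta ->
  mdist (T (xi (m - 1))) (eta m) < d ->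
  pseudo_orbit T d (glue m xi eta).
Proof.
move=> xiP etaP jumpP n; rewrite /glue.
have [nm|nm] := ltP (n + 1) m.
  by rewrite (_ : n < m) //; lia.
have [nm'|nm'] := ltP n m; last exact: etaP.
have -> : n = m - 1 by lia.
by rewrite subrK.
Qed.

(** Jumps accumulate in a controlled way over [n] steps, by uniform continuity
    of [T].  For [n < 0], the forward estimate from [m + n] to [m] is pulled
    back by the uniformly continuous map [iterz T n]. *)
Lemma pseudo_orbit_drift (n : int) (s : R) : 0 < s ->
  exists2 d : R, 0 < d & forall xi m, pseudo_orbit T d xi ->
    mdist (iterz T n (xi m)) (xi (m + n)) < s.
Proof.
have fwd (k : nat) (r : R) : 0 < r ->
  exists2 d : R, 0 < d & forall xi m, pseudo_orbit T d xi ->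
    mdist (iterz T k (xi m)) (xi (m + k%:Z)) < r.
  elim: k r => [|k IH] r r0.
    by exists 1 => // xi m _; rewrite addr0 mdistxx.
  have r2 : 0 < r / 2 by rewrite divr_gt0.
  have [e e0 eP] :=
    uniform_continuity X_compact (@homeo_fun_continuous _ T) r2.
  have [d d0 dP] := IH e e0.
  exists (Num.min d (r / 2)); first by rewrite lt_min d0.
  move=> xi m xiP.
  have xid : pseudo_orbit T d xi.
    by apply: pseudo_orbit_le xiP; rewrite ge_min lexx.
  have xir : pseudo_orbit T (r / 2) xi.
    by apply: pseudo_orbit_le xiP; rewrite ge_min lexx orbT.
  have h1 := eP _ _ (dP xi m xid).
  have h2 := xir (m + k%:Z).
  have t := metric_triangle (T (iterz T k (xi m))) (T (xi (m + k%:Z)))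
              (xi (m + k%:Z + 1)).
  by rewrite -addn1 PoszD iterzS addrA; lra.
move=> s0; case: n => [n|n]; first exact: fwd.
have [e e0 eP] :=
  uniform_continuity X_compact (@iterz_continuous _ T (Negz n)) s0.
have [d d0 dP] := fwd n.+1 e e0.
exists d => // xi m xiP.
have := eP _ _ (dP xi (m + Negz n) xiP).
by rewrite -iterzD NegzE addNr subrK metric_sym.
Qed.

Variable alpha : R.
Hypothesis T_expansive : expansivity_constant T alpha.

(** Rigidity.  Since [alpha] itself, rather than a smaller bound, is allowed
    in the assumption, the lemma applies to the shadowing supplied by one-jump
    pseudo orbits, and to sums of two errors bounded by [alpha / 2]. *)
Lemma expansive_tracking (g : R) : 0 < g ->
  exists2 d : R, 0 < d & forall xi w, pseudo_orbit T d xi ->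
    (forall n, mdist (xi n) (iterz T n w) <= alpha) ->
    forall n, mdist (xi n) (iterz T n w) < g.
Proof.
move=> g0; apply: contrapT => nd.
have ce k : exists u : (int -> X) * X * int,
    [/\ pseudo_orbit T k.+1%:R^-1 u.1.1,
        forall n, mdist (u.1.1 n) (iterz T n u.1.2) <= alpha &
        g <= mdist (u.1.1 u.2) (iterz T u.2 u.1.2)].
  apply: contrapT => nu; apply: nd; exists k.+1%:R^-1 => // xi w xiP wP n.
  by rewrite ltNge; apply/negP => gn; apply: nu; exists (xi, w, n).
have [u uP] := choice ce.
(* The counterexample, recentred at the time where it fails. *)
pose v k := ((u k).1.1 (u k).2, iterz T (u k).2 (u k).1.2).
have [p pP] := @compact_limit_le R _ (compact_square X_compact) v.
have p12 : p.1 = p.2.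
  apply: T_expansive.2 => n.
  apply: (pP (fun q => mdist (iterz T n q.1) (iterz T n q.2))) => [|s s0].
    by apply: continuous_mdist_map2; exact: iterz_continuous.
  have [d d0 dP] := pseudo_orbit_drift n s0.
  near=> k; have [xiP wP _] := uP k.
  have xid : pseudo_orbit T d (u k).1.1.
    apply: pseudo_orbit_le xiP; apply: ltW.
    by near: k; exact: near_invSn_lt.
  have h1 := dP _ (u k).2 xid.
  have h2 := wP ((u k).2 + n).
  rewrite addrC iterzD [n + _]addrC in h2.
  have t := metric_triangle (iterz T n (v k).1) ((u k).1.1 ((u k).2 + n))
    (iterz T n (v k).2).
  by rewrite /v/= in t *; lra.
have : - mdist p.1 p.2 <= - g.
  apply: (pP (fun q => - mdist q.1 q.2)) => [q|s s0].
    by apply: cvgN; exact: mdist_continuous.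
  by near=> k; have [_ _] := uP k; rewrite /v/=; lra.
by rewrite p12 mdistxx; lra.
Unshelve. all: by end_near. Qed.

(** Passing to the limit in the window only preserves the large inequality;
    [expansive_tracking] restores the strict one. *)
Lemma shadowed_of_windows (g : R) (xi : int -> X) :
  (forall M : nat, exists w, forall n : int, `|n| <= M%:Z ->
     mdist (xi n) (iterz T n w) < g) ->
  exists w, forall n, mdist (xi n) (iterz T n w) <= g.
Proof.
move=> /choice[w wP].
have [p pP] := @compact_limit_le R _ X_compact w.
exists p => n.
apply: (pP (fun q => mdist (xi n) (iterz T n q))) => [|s s0].
  by apply: continuous_mdist_comp => q; [exact: cvg_cst | exact: iterz_continuous].
exists `|n|%N => // k /= nk.
by rewrite -[leLHS]addr0 lerD ?(ltW s0)// ltW// wP//; lia.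
Qed.

Lemma no_jump_off_gluing (m n : int) a y : n != m ->
  ~ jump_at T (glue m (orbit_through T m a) (orbit_through T m y)) n.
Proof.
rewrite /jump_at /glue => nm; apply.
have [lt1|le1] := ltP (n - 1) m; rewrite orbit_throughS subrK.
  by rewrite (_ : n < m) //; lia.
by rewrite (_ : (n < m) = false) //; lia.
Qed.

Variable delta : R.
Hypothesis delta_gt0 : 0 < delta.
Hypothesis one_jump_shadowed : forall xi : int -> X,
  one_jump_pseudo_orbit T delta xi -> shadowed T alpha xi.

(** Either the two orbits agree, and no jump occurs, or the one-jump hypothesis
    applies and its precision [alpha] is improved by rigidity. *)
Lemma one_jump_shadowed_small (b : R) : 0 < b ->
  exists2 r : R, 0 < r & forall (m : int) a y, mdist a y < r ->
    shadowed T b (glue m (orbit_through T m a) (orbit_through T m y)).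
Proof.
move=> b0; have [d d0 dP] := expansive_tracking b0.
exists (Num.min delta d); first by rewrite lt_min delta_gt0.
move=> m a y; rewrite lt_min => /andP[ay1 ay2].
have po r : 0 < r -> mdist a y < r -> pseudo_orbit T r
    (glue m (orbit_through T m a) (orbit_through T m y)).
  move=> r0 ayr; apply: pseudo_orbit_glue.
  - exact: pseudo_orbit_orbit_through.
  - exact: pseudo_orbit_orbit_through.
  - by rewrite orbit_throughS subrK !orbit_through_id.
have [ay|ay] := pselect (a = y).
  exists (iterz T (- m) y) => n.
  by rewrite ay /glue -orbit_throughE if_same mdistxx.
have [|w wP] := @one_jump_shadowed
    (glue m (orbit_through T m a) (orbit_through T m y)).
  split; first exact: po.
  exists m; split.
    rewrite /jump_at /glue ltxx (_ : m - 1 < m); last by lia.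
    by rewrite orbit_throughS subrK !orbit_through_id.
  move=> n; have [->//|nm] := eqVneq n m.
  by move/(no_jump_off_gluing nm).
by exists w; apply: dP; [exact: po | move=> n; exact: ltW].
Qed.

Lemma shadowing_of_one_jump_shadowing : shadowing_property T.
Proof.
move=> e e0; have [alpha0 _] := T_expansive.
have a2 : 0 < alpha / 2 by rewrite divr_gt0.
have [r r0 rP] := one_jump_shadowed_small a2.
pose g := Num.min e (Num.min (alpha / 2) (r / 2)).
have g0 : 0 < g by rewrite !lt_min e0 a2 divr_gt0.
have [ge ga gr] : [/\ g <= e, g <= alpha / 2 & g <= r / 2].
  by split; rewrite /g !ge_min lexx ?orbT.
have [d1 d10 d1P] := expansive_tracking g0.
have r2 : 0 < r / 2 by rewrite divr_gt0.
exists (Num.min d1 (r / 2)); first by rewrite lt_min d10.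
set d := Num.min d1 _.
have d0 : 0 < d by rewrite lt_min d10.
have [dd1 dr] : d <= d1 /\ d <= r / 2.
  by split; rewrite /d ge_min lexx ?orbT.
(* Adding one jump: the error [g + alpha / 2] is reset to [g] by [d1P]. *)
have step m xi : pseudo_orbit T d xi ->
    shadowed T g (glue m xi (orbit_through T m (xi m))) ->
    shadowed T g (glue (m + 1) xi (orbit_through T (m + 1) (xi (m + 1)))).
  move=> xiP [w wP].
  have po : pseudo_orbit T d1
      (glue (m + 1) xi (orbit_through T (m + 1) (xi (m + 1)))).
    apply: pseudo_orbit_le dd1 _; apply: pseudo_orbit_glue => //.
      exact: pseudo_orbit_orbit_through.
    by rewrite addrK orbit_through_id.
  (* The error [g] of [w] and the jump at [m + 1] each use half of [r]. *)
  have wy : mdist (iterz T (m + 1) w) (xi (m + 1)) < r.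
    have := wP (m + 1); rewrite /glue gtrDl ltr10.
    rewrite -orbit_throughS orbit_through_id => h.
    have h2 := xiP m.
    have t := metric_triangle (iterz T (m + 1) w) (T (xi m)) (xi (m + 1)).
    by rewrite (metric_sym _ (T (xi m))) in t; lra.
  have [z zP] := rP (m + 1) _ _ wy.
  exists z; apply: d1P => // n; have := zP n; rewrite /glue.
  have [nm|nm] := ltP n (m + 1); last by move=> h; lra.
  rewrite orbit_through_iterz => h.
  have := wP n; rewrite glue_orbit_before//.
  have t := metric_triangle (xi n) (iterz T n w) (iterz T n z).
  by move=> h2; lra.
move=> xi xiP.
have [M|w wP] := @shadowed_of_windows g xi.
  pose l : int := - M%:Z.
  pose eta := glue l (orbit_through T l (xi l)) xi.
  have etaP : pseudo_orbit T d eta.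
    apply: pseudo_orbit_glue => //; first exact: pseudo_orbit_orbit_through.
    by rewrite orbit_throughS subrK orbit_through_id mdistxx.
  (* [eta] has no jump up to time [l], and each step allows one more. *)
  have shadow k :
      shadowed T g (glue (l + k%:Z) eta
        (orbit_through T (l + k%:Z) (eta (l + k%:Z)))).
    elim: k => [|k IH]; last by rewrite -addn1 PoszD addrA; exact: step.
    exists (iterz T (- l) (xi l)) => n.
    rewrite addr0 -orbit_throughE /glue /eta /glue ltxx.
    by case: (n < l); rewrite mdistxx.
  have [w wP] := shadow (M + M)%N.+1.
  exists w => n nM; have := wP n.
  by rewrite glue_truncation.
exists w => n; apply: lt_le_trans ge.
apply: d1P => [|k]; first exact: pseudo_orbit_le xiP.
by have := wP k; lra.
Qed.

End Shadowing.

Theorem proposition4p1 (R : realType) (X : metricType R)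
    (X_compact : compact [set: X]) (T : homeomorphism X) (alpha : R)
    (T_expansive : expansivity_constant T alpha) :
  shadowing_property T <->
  exists2 delta : R, 0 < delta &
    forall xi : int -> X, one_jump_pseudo_orbit T delta xi -> shadowed T alpha xi.
Proof.
split=> [sh|[delta delta0 deltaP]].
  have [delta delta0 deltaP] := sh alpha T_expansive.1.
  by exists delta => // xi [xiP _]; exact: deltaP.
exact: (shadowing_of_one_jump_shadowing X_compact T_expansive delta0 deltaP).
Qed.
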